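(* Let $\omega \in \{0,1,2\}^\infty$ be a sequence without repetition. Then the action of the Grigorchuk group $G_\omega$ on the cube complex $\mathcal{X}$ is proper and faithful.
   Context: A sequence $\omega=\omega_1\omega_2\ldots$ is without repetition if $\omega_i \neq \omega_{i+1}$ for every $i$. Grigorchuk groups: let $\mathcal{T}_2$ be the infinite binary rooted tree, whose vertices are the finite binary sequences. Let $\sigma$ be the shift on $\{0,1,2\}^\infty$. For $\omega \in \{0,1,2\}^\infty$, $G_\omega$ is the subgroup of $\mathrm{Aut}(\mathcal{T}_2)$ generated by $a, b_\omega, c_\omega, d_\omega$, where, for all binary sequences $x$, $a(0x)=1x$, $a(1x)=0x$, and $b_\omega(0x) = 0a(x)$ if $\omega_1 \neq 2$, $b_\omega(0x)=0x$ if $\omega_1=2$, $b_\omega(1x)=1b_{\sigma\omega}(x)$; $c_\omega(0x) = 0a(x)$ if $\omega_1 \neq 1$, $c_\omega(0x)=0x$ if $\omega_1=1$, $c_\omega(1x)=1c_{\sigma\omega}(x)$; $d_\omega(0x) = 0a(x)$ if $\omega_1 \neq 0$, $d_\omega(0x)=0x$ if $\omega_1=0$, $d_\omega(1x)=1d_{\sigma\omega}(x)$. The action extends to the boundary $\partial\mathcal{T}_2 = \{0,1\}^\infty$. The graph $\Gamma$: it has vertex set $V(\Gamma) = G_\omega 0^\infty$ (the set of infinite binary sequences with finitely many $1$'s) and an edge joining $x$ to $sx$ for each vertex $x$ and each $s \in \{a,b_\omega,c_\omega,d_\omega\}$; as an unlabelled graph it does not depend on $\omega$. Up to loops and multiple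 edges it is a bi-infinite line, drawn so that the right neighbour of $0^\infty$ is $10^\infty$ and its left neighbour is $010^\infty$. $\Gamma_+ \subset V(\Gamma)$ is the set consisting of $0^\infty$ and all the vertices to the right of it, i.e. the vertices of the connected component of $\Gamma \setminus \{0^\infty\}$ containing $10^\infty$. The cube complex $\mathcal{X}$: its vertices are the subsets $\Omega \subset V(\Gamma)$ with $\Omega \triangle \Gamma_+$ finite; two vertices are joined by an edge iff their symmetric difference has exactly one element; the $n$-cubes correspond to pairs $(A,F)$ with $F\subset V(\Gamma)$ of cardinality $n$ and $A\subset V(\Gamma)\setminus F$ a vertex of $\mathcal{X}$, the vertices of the cube being the sets $A\cup B$, $B \subset F$. $G_\omega$ acts on $\mathcal{X}$ by $\Omega \mapsto g\Omega$. An action on a cube complex is proper if the stabilizers of all cubes are finite. *)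

(* Defs.v *)
From HB Require Import structures.
From Stdlib Require Import Relation_Operators.
From mathcomp Require Import all_boot.
From mathcomp Require Import boolp classical_sets functions cardinality.

Set Implicit Arguments.
Unset Strict Implicit.
Unset Printing Implicit Defensive.

Local Open Scope group_scope.
Local Open Scope classical_set_scope.
Local Open Scope card_scope.

(* The binary digits 0 and 1 are [false] and [true]; sequences are indexed
   from 0, so omega_i is [w i.-1].  The vertices of T_2 are the [seq bool]. *)

Definition without_repetition (w : nat -> 'I_3) : Prop :=
  forall i : nat, w i != w i.+1.

Definition shift (w : nat -> 'I_3) : nat -> 'I_3 := fun i => w i.+1.

Definition tree_adj (u v : seq bool) : Prop :=
  exists x : bool, v = rcons u x \/ u = rcons v x.

Record tree_aut := TreeAut {
  taut :> seq bool -> seq bool;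
  taut_inv : seq bool -> seq bool;
  tautK : cancel taut taut_inv;
  taut_invK : cancel taut_inv taut;
  taut_root : taut [::] = [::];
  taut_adj : forall u v, tree_adj (taut u) (taut v) <-> tree_adj u v
}.

Lemma tree_aut_ext (g h : tree_aut) : taut g =1 taut h -> g = h.
Proof.
case: g h => [f f' fK f'K f0 fA] [k k' kK k'K k0 kA] /= /funext fk; subst k.
have kf : f' = k' by apply/funext => u; rewrite -{1}(k'K u) fK.
subst k'; congr TreeAut; exact: Prop_irrelevance.
Qed.

Definition taut_one : tree_aut :=
  @TreeAut id id (fun=> erefl) (fun=> erefl) erefl
    (fun u v => iff_refl (tree_adj u v)).

Definition taut_comp (g h : tree_aut) : tree_aut.
Proof.
refine (@TreeAut (taut g \o taut h) (taut_inv h \o taut_inv g) _ _ _ _).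
- exact: can_comp (@tautK g) (@tautK h).
- exact: can_comp (@taut_invK h) (@taut_invK g).
- by rewrite /= !taut_root.
- by move=> u v /=; rewrite !taut_adj.
Defined.

Definition taut_opp (g : tree_aut) : tree_aut.
Proof.
refine (@TreeAut (taut_inv g) (taut g) (@taut_invK g) (@tautK g) _ _).
- by rewrite -{1}(taut_root g) tautK.
- by move=> u v; rewrite -(taut_adj g) !taut_invK.
Defined.

HB.instance Definition _ := gen_eqMixin tree_aut.
HB.instance Definition _ := gen_choiceMixin tree_aut.

Fact taut_mulA : associative taut_comp.
Proof. by move=> g h k; apply: tree_aut_ext. Qed.
Fact taut_mul1g : left_id taut_one taut_comp.
Proof. by move=> g; apply: tree_aut_ext. Qed.
Fact taut_mulg1 : right_id taut_one taut_comp.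
Proof. by move=> g; apply: tree_aut_ext. Qed.
Fact taut_mulVg : left_inverse taut_one taut_opp taut_comp.
Proof. by move=> g; apply: tree_aut_ext => u /=; rewrite tautK. Qed.
Fact taut_mulgV : right_inverse taut_one taut_opp taut_comp.
Proof. by move=> g; apply: tree_aut_ext => u /=; rewrite taut_invK. Qed.

HB.instance Definition _ := isGroup.Build tree_aut
  taut_mulA taut_mul1g taut_mulg1 taut_mulVg taut_mulgV.

Definition is_subgroup (gT : groupType) (H : set gT) : Prop :=
  [/\ H 1, forall x y, H x -> H y -> H (x * y) & forall x, H x -> H x^-1].

Definition generated (gT : groupType) (S : set gT) : set gT :=
  smallest (@is_subgroup gT) S.

Lemma generated_subgroup (gT : groupType) (S : set gT) :
  is_subgroup (generated S).
Proof.
split=> [H [[H1 _ _] _] //|x y Sx Sy H HS|x Sx H HS].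
- by case: (HS) => -[_ HM _] _; apply: HM; [apply: Sx | apply: Sy].
- by case: (HS) => -[_ _ HV] _; apply: HV; apply: Sx.
Qed.

Definition flip_word (v : seq bool) : seq bool :=
  if v is x :: v' then ~~ x :: v' else [::].

(* Common form of b, c, d: [spin_word k] acts trivially below a digit 0
   exactly when the current letter of the sequence is [k]. *)
Fixpoint spin_word (k : nat) (w : nat -> 'I_3) (v : seq bool) : seq bool :=
  match v with
  | [::] => [::]
  | false :: x => false :: (if w 0 != k :> nat then flip_word x else x)
  | true :: x => true :: spin_word k (shift w) x
  end.

Lemma flip_wordK : involutive flip_word.
Proof. by case=> //= x v; rewrite negbK. Qed.

Lemma spin_wordK k w : involutive (spin_word k w).
Proof.
move=> v; elim: v w => [|[] v IHv] w //=; first by rewrite IHv.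
by case: (w 0 != k :> nat); rewrite //= flip_wordK.
Qed.

Lemma flip_word_rcons v x : exists y, flip_word (rcons v x) = rcons (flip_word v) y.
Proof. by case: v => [|z v] /=; [exists (~~ x) | exists x]. Qed.

Lemma spin_word_rcons k w v x :
  exists y, spin_word k w (rcons v x) = rcons (spin_word k w v) y.
Proof.
elim: v w => [|[] v IHv] w /=.
- by case: x => /=; [exists true | case: ifP => _; exists false].
- by have [y ->] := IHv (shift w); exists y.
- case: ifP => _; last by exists x.
  by have [y ->] := flip_word_rcons v x; exists y.
Qed.

Lemma involutive_tree_adj (f : seq bool -> seq bool) :
  involutive f -> (forall v x, exists y, f (rcons v x) = rcons (f v) y) ->
  forall u v, tree_adj (f u) (f v) <-> tree_adj u v.
Proof.
move=> fK fr.
have fA u v : tree_adj u v -> tree_adj (f u) (f v).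
  by move=> [x [->|->]]; [have [y ->] := fr u x | have [y ->] := fr v x];
    exists y; [left | right].
by move=> u v; split=> [/fA|/fA//]; rewrite !fK.
Qed.

Definition flip_aut : tree_aut :=
  TreeAut flip_wordK flip_wordK erefl
    (involutive_tree_adj flip_wordK flip_word_rcons).

Definition spin_aut (k : nat) (w : nat -> 'I_3) : tree_aut :=
  TreeAut (spin_wordK k w) (spin_wordK k w) erefl
    (involutive_tree_adj (spin_wordK k w) (spin_word_rcons k w)).

Definition gen_a : tree_aut := flip_aut.
Definition gen_b (w : nat -> 'I_3) : tree_aut := spin_aut 2 w.
Definition gen_c (w : nat -> 'I_3) : tree_aut := spin_aut 1 w.
Definition gen_d (w : nat -> 'I_3) : tree_aut := spin_aut 0 w.

Definition gens (w : nat -> 'I_3) : set tree_aut :=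
  [set gen_a; gen_b w; gen_c w; gen_d w].

Definition grigorchuk (w : nat -> 'I_3) : set tree_aut := generated (gens w).

Definition ray := nat -> bool.

(* The image of a ray is the ray through the images of its finite prefixes. *)
Definition ray_act (g : tree_aut) (x : ray) : ray :=
  fun n => nth false (g (mkseq x n.+1)) n.

Definition zero_ray : ray := fun=> false.
Definition one_zero_ray : ray := fun n => n == 0.

Definition Gamma_V (w : nat -> 'I_3) : set ray :=
  [set ray_act g zero_ray | g in grigorchuk w].

(* Edges of Gamma, oriented from x to s x. *)
Definition Gamma_arc (w : nat -> 'I_3) (x y : ray) : Prop :=
  Gamma_V w x /\ exists2 s, gens w s & y = ray_act s x.

(* Connected component, in the graph Gamma minus 0^oo, of the vertex x. *)
Definition component_off_zero (w : nat -> 'I_3) (x : ray) : set ray :=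
  [set y | clos_refl_sym_trans ray
     (fun u v => [/\ u <> zero_ray, v <> zero_ray & Gamma_arc w u v]) x y].

Definition Gamma_plus (w : nat -> 'I_3) : set ray :=
  zero_ray |` component_off_zero w one_zero_ray.

Definition X_vertex (w : nat -> 'I_3) : set (set ray) :=
  [set Om | Om `<=` Gamma_V w /\ finite_set (Om `+` Gamma_plus w)].

(* A cube is given by its set of vertices; the edges are the 1-cubes. *)
Definition X_cube (w : nat -> 'I_3) (n : nat) : set (set (set ray)) :=
  [set C | exists A F : set ray,
     [/\ F `<=` Gamma_V w, F #= `I_n, X_vertex w A, A `<=` Gamma_V w `\` F
       & C = [set A `|` B | B in [set B | B `<=` F]]]].

Definition set_act (g : tree_aut) (Om : set ray) : set ray := ray_act g @` Om.

Definition proper_action (gT : groupType) (T : Type) (G : set gT)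
    (act : gT -> T -> T) (cube : nat -> set (set T)) : Prop :=
  forall (n : nat) (C : set T), cube n C ->
    finite_set [set g | G g /\ act g @` C = C].

Definition faithful_action (gT : groupType) (T : Type) (G : set gT)
    (act : gT -> T -> T) (vertex : set T) : Prop :=
  forall g : gT, G g -> (forall x, vertex x -> act g x = x) -> g = 1.

(* The following lemmas check that [set_act] is an action of the Grigorchuk
   group on the cube complex. *)

Lemma taut_rcons (g : tree_aut) v x : exists y, g (rcons v x) = rcons (g v) y.
Proof.
elim/last_ind: v x => [|v z IHv] x.
  have /(taut_adj g) : tree_adj [::] (rcons [::] x) by exists x; left.
  rewrite taut_root => -[y [->|]]; first by exists y.
  by move/(congr1 size); rewrite size_rcons.
have /(taut_adj g) : tree_adj (rcons v z) (rcons (rcons v z) x) by exists x; left.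
case=> y [->|E]; first by exists y.
have [t Et] := IHv z; move: E; rewrite Et => /rcons_inj[].
move=> /(can_inj (@tautK g))/(congr1 size)/eqP.
by rewrite !size_rcons -addn2 -[size v in X in X == _]addn0 eqn_add2l.
Qed.

Lemma size_taut (g : tree_aut) v : size (g v) = size v.
Proof.
elim/last_ind: v => [|v x IHv]; first by rewrite taut_root.
by have [y ->] := taut_rcons g v x; rewrite !size_rcons IHv.
Qed.

Lemma mkseqSr (x : ray) n : mkseq x n.+1 = rcons (mkseq x n) (x n).
Proof. by rewrite /mkseq -addn1 iotaD map_cat cats1. Qed.

Lemma mkseq_ray_act g x n : mkseq (ray_act g x) n = g (mkseq x n).
Proof.
elim: n => [|n IHn]; first by rewrite /= taut_root.
rewrite mkseqSr IHn /ray_act mkseqSr.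
have [y ->] := taut_rcons g (mkseq x n) (x n).
by rewrite nth_rcons size_taut size_mkseq ltnn eqxx.
Qed.

Lemma ray_act1 : ray_act 1 = id.
Proof.
by apply/funext => x; apply/funext => n; rewrite /ray_act nth_mkseq.
Qed.

Lemma ray_actM g h : ray_act (g * h) = ray_act g \o ray_act h.
Proof.
by apply/funext => x; apply/funext => n /=; rewrite /ray_act mkseq_ray_act.
Qed.

Lemma set_act1 : set_act 1 = id.
Proof. by apply/funext => A; rewrite /set_act ray_act1 image_id. Qed.

Lemma set_actM g h : set_act (g * h) = set_act g \o set_act h.
Proof. by apply/funext => A; rewrite /set_act ray_actM -image_comp. Qed.

Lemma ray_act_inj g : injective (ray_act g).
Proof.
have K : cancel (ray_act g) (ray_act g^-1).
  by move=> x; have := ray_actM g^-1 g; rewrite mulVg ray_act1 => /(congr1 (@^~ x)).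
exact: can_inj K.
Qed.

Lemma Gamma_V_act w g x : grigorchuk w g -> Gamma_V w x -> Gamma_V w (ray_act g x).
Proof.
move=> Gg [h Gh <-]; exists (g * h); last by rewrite ray_actM.
by have [_ GM _] := generated_subgroup (gens w); apply: GM.
Qed.

Lemma gensV w s : gens w s -> s^-1 = s.
Proof. by move=> [[[->|->]|->]|->]; apply: tree_aut_ext. Qed.

Lemma set_actY g A B : set_act g (A `+` B) = set_act g A `+` set_act g B.
Proof.
apply/seteqP; split=> [_ [x + <-]|].
  move=> [[Ax nBx]|[Bx nAx]]; [left | right]; split; try by exists x.
  - by move=> [y By /ray_act_inj E]; apply: nBx; rewrite -E.
  - by move=> [y By /ray_act_inj E]; apply: nAx; rewrite -E.
move=> y [[[x Ax <-] nB]|[[x Bx <-] nA]]; exists x => //; [left | right].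
  by split=> // Bx; apply: nB; exists x.
by split=> // Ax; apply: nA; exists x.
Qed.

Lemma finite_setY_trans (T : Type) (A B C : set T) :
  finite_set (A `+` B) -> finite_set (B `+` C) -> finite_set (A `+` C).
Proof.
have -> : A `+` C = (A `+` B) `+` (B `+` C).
  by rewrite setYA -(setYA A) setYK setY0.
by move=> fAB fBC; rewrite finite_setU; split; apply: finite_setD.
Qed.

Lemma gens_Gamma_plus w s : gens w s ->
  finite_set (set_act s (Gamma_plus w) `+` Gamma_plus w).
Proof.
move=> Ss.
have sK x : ray_act s (ray_act s x) = x.
  have := ray_actM s s; rewrite -{1}(gensV Ss) mulVg ray_act1.
  by move=> /(congr1 (@^~ x)).
have V1 : Gamma_V w one_zero_ray.
  exists gen_a; first by apply: sub_gen_smallest; left; left; left.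
  apply/funext => -[|n] //; rewrite -[LHS]/(nth false (map zero_ray (iota 1 n.+1)) n).
  by rewrite (nth_map 0) ?size_iota.
have pV x : Gamma_plus w x -> x = zero_ray \/ Gamma_V w x.
  move=> [->|Cx]; [by left | right].
  suff : Gamma_V w one_zero_ray <-> Gamma_V w x by move=> <-.
  elim: Cx => {x} [u v [_ _ [Vu [t St ->]]]|//|u v _ ->//|u v t _ -> _ ->//].
  by split=> // _; apply: Gamma_V_act => //; apply: sub_gen_smallest.
have step x : Gamma_plus w x -> x <> zero_ray -> ray_act s x <> zero_ray ->
    Gamma_plus w (ray_act s x).
  move=> Px x0 sx0; have [//|Vx] := pV x Px.
  case: Px => [//|Cx]; right; apply: rst_trans Cx _; apply: rst_step.
  by split=> //; split=> //; exists s.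
apply: (@sub_finite_set _ _ [set zero_ray; ray_act s zero_ray]); last first.
  exact: finite_set2.
move=> y [[[x Px <-] nP]|[Py nP]].
  have [->|x0] := pselect (x = zero_ray); first by right.
  have [->|sx0] := pselect (ray_act s x = zero_ray); first by left.
  by case: nP; apply: step.
have [->|y0] := pselect (y = zero_ray); first by left.
have [sy0|sy0] := pselect (ray_act s y = zero_ray).
  by right; rewrite /= -sy0 sK.
by case: nP; exists (ray_act s y); [apply: step | apply: sK].
Qed.

Lemma grigorchuk_Gamma_plus w g : grigorchuk w g ->
  finite_set (set_act g (Gamma_plus w) `+` Gamma_plus w).
Proof.
pose H := [set g | finite_set (set_act g (Gamma_plus w) `+` Gamma_plus w)].
apply: (@smallest_sub _ _ _ H); last exact: gens_Gamma_plus.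
split=> [|x y Hx Hy|x Hx].
- by rewrite /H /= set_act1 setYK; apply: finite_set0.
- rewrite /H /= set_actM /=.
  apply: (finite_setY_trans _ Hx).
  by rewrite -set_actY; apply: finite_image.
- have := @finite_image _ _ _ (ray_act x^-1) Hx.
  rewrite -/(set_act _ _) set_actY.
  have := set_actM x^-1 x; rewrite mulVg set_act1.
  by move=> /(congr1 (@^~ (Gamma_plus w)))/= <-; rewrite setYC.
Qed.

Lemma X_vertex_act w g Om :
  grigorchuk w g -> X_vertex w Om -> X_vertex w (set_act g Om).
Proof.
move=> Gg [OmV fin]; split.
  by move=> _ [x Ox <-]; apply: Gamma_V_act => //; apply: OmV.
apply: (finite_setY_trans _ (grigorchuk_Gamma_plus Gg)).
by rewrite -set_actY; apply: finite_image.
Qed.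

Lemma X_cube_act w g n C :
  grigorchuk w g -> X_cube w n C -> X_cube w n (set_act g @` C).
Proof.
move=> Gg [A [F [FV Fn XA AVF ->]]]; exists (set_act g A), (set_act g F); split.
- by move=> _ [x Fx <-]; apply: Gamma_V_act => //; apply: FV.
- apply: card_eq_trans Fn; apply: inj_card_eq => x y _ _; exact: ray_act_inj.
- exact: X_vertex_act.
- move=> _ [x Ax <-]; have [Vx nFx] := AVF x Ax; split.
    exact: Gamma_V_act.
  by move=> [y Fy /ray_act_inj E]; apply: nFx; rewrite -E.
- apply/seteqP; split=> [_ [_ [B BF <-] <-]|_ [B BF <-]].
    exists (set_act g B); first exact: image_subset.
    by rewrite /set_act image_setU.
  exists (A `|` (F `&` ray_act g @^-1` B)).
    by exists (F `&` ray_act g @^-1` B) => // x [].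
  rewrite /set_act image_setU; congr (_ `|` _); apply/seteqP; split.
    by move=> _ [x [Fx Bx] <-].
  by move=> y By; have [x Fx E] := BF y By; exists x => //; split; rewrite //= E.
Qed.

(* Main.v *)
Require Import Defs.
From Stdlib Require Import Relation_Operators.
From mathcomp Require Import all_boot.
From mathcomp Require Import boolp classical_sets functions cardinality.

(** Read from [0^oo], the line has the following shape: a nonzero finitely
    supported ray lies to the right of [0^oo] exactly when its last digit 1 sits
    at an even index (indices start at 0), to the left when that index is odd
    ([Gamma_plusE]).  So [Gamma_plus] is a set of the form [ends e i], the rays
    whose last 1 has index of parity [i], together with [0^oo] when [e] holds.
    This family is stable under passing to the two halves of the tree
    ([ends_cons]), and a vertex of the complex, being a finite modification of
    [Gamma_plus] inside finitely supported rays, restricts to a set of this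
    form on every subtree of some fixed depth [n].  Hence if [g] stabilises a
    vertex, its sections at depth [n] carry some [ends e i] to some
    [ends e' i].  Since [g] is determined by its action on level [n] and its
    sections there, properness follows once the elements carrying [ends e i]
    to [ends e' i] are known to be finite in number.

    This is the core of the proof ([stabiliser_ends]): such an element forces
    [e = e'], lies in [{1, b, c, d}] when [e = i], and has both sections trivial
    or equal to the spin of index [w 0] when [e <> i].  The proof is an
    induction on word length: a word containing the letter [a] has strictly
    shorter sections ([word_contraction_ind]), and the sections satisfy the same hypothesis.  When they are known, an element
    of the group is further restricted by parity invariants.  The essential one
    says that the two sections of an element have images in a dihedral quotient
    of order 8 that correspond under the automorphism exchanging the two
    generating reflections ([octal_section]); absence of repetition is what makes
    these invariants functions of the automorphism and not only of the word
    ([active_det]).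

    A cube is stabilised only if its smallest vertex is, so the case of vertices
    suffices.  For faithfulness, an element fixing the vertices [Gamma_plus] and
    [Gamma_plus] minus a point [y] fixes [y], and every finite word is a prefix
    of some ray in [Gamma_plus]. *)

Set Implicit Arguments.
Unset Strict Implicit.
Unset Printing Implicit Defensive.

Local Open Scope group_scope.
Local Open Scope classical_set_scope.

(** * Words and sections *)

(** [None] stands for [a] and [Some k] for the spin of index [k]. *)
Notation letter := (option 'I_3).

Definition letter_aut (w : nat -> 'I_3) (l : letter) : tree_aut :=
  if l is Some k then spin_aut k w else flip_aut.

Definition word_aut (w : nat -> 'I_3) (u : seq letter) : tree_aut :=
  foldr (fun l g => letter_aut w l * g) 1 u.

Definition swaps (u : seq letter) : bool := odd (count_mem None u).

(** A word for the section of [word_aut w u] at the digit [x].  Only the digit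
    met by each spin matters: at 1 the spin goes on below as itself, at 0 it
    acts as [a] or trivially. *)
Fixpoint section (w : nat -> 'I_3) (x : bool) (u : seq letter) : seq letter :=
  match u with
  | [::] => [::]
  | None :: u' => section w x u'
  | Some k :: u' =>
      if x (+) swaps u' then Some k :: section w x u'
      else if w 0 != k then None :: section w x u' else section w x u'
  end.

Lemma swaps_cons l u : swaps (l :: u) = (l == None) (+) swaps u.
Proof. by rewrite /swaps /= oddD; case: l. Qed.

Lemma word_aut_cons w l u v :
  word_aut w (l :: u) v = letter_aut w l (word_aut w u v).
Proof. by []. Qed.

Lemma word_aut_cat w u1 u2 : word_aut w (u1 ++ u2) = word_aut w u1 * word_aut w u2.
Proof. by elim: u1 => [|l u1 IH] /=; rewrite ?mul1g // IH mulgA. Qed.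

Lemma word_aut_section w u x v :
  word_aut w u (x :: v) =
  (x (+) swaps u) :: word_aut (shift w) (section w x u) v.
Proof.
elim: u => [|l u IH]; first by rewrite /= addbF.
rewrite word_aut_cons IH swaps_cons; case: l => [k|] /=.
  by case: (x (+) swaps u) => //=; case: ifP.
by rewrite addbN.
Qed.

Lemma gensP w s : gens w s <-> exists l, s = letter_aut w l.
Proof.
split=> [|[[[[|[|[|//]]] lt3]|]] ->].
- move=> [[[->|->]|->]|->]; first by exists None.
  + by exists (Some (inord 2)); rewrite /= inordK.
  + by exists (Some (inord 1)); rewrite /= inordK.
  + by exists (Some (inord 0)); rewrite /= inordK.
- by right.
- by left; right.
- by left; left; right.
- by left; left; left.
Qed.

Lemma grigorchuk_word w g : grigorchuk w g -> exists u, g = word_aut w u.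
Proof.
apply: (@smallest_sub _ _ _ [set g | exists u, g = word_aut w u]).
  split=> [|_ _ [u1 ->] [u2 ->]|_ [u ->]]; first by exists [::].
    by exists (u1 ++ u2); rewrite word_aut_cat.
  exists (rev u); elim: u => [|l u IH]; first by rewrite invg1.
  rewrite rev_cons -cats1 word_aut_cat -IH /= mulg1 invgM.
  have Sl : gens w (letter_aut w l) by apply/gensP; exists l.
  by rewrite (gensV Sl).
by move=> s /gensP[l ->]; exists [:: l]; rewrite /= mulg1.
Qed.

(** The letters [a] disappear in the sections and each spin leaves at most one
    letter. *)
Lemma size_section w x u : size (section w x u) <= count isSome u.
Proof.
elim: u => [|[k|] u IH] //=.
by do 2?case: ifP => _ //=; rewrite ?add1n ?ltnS // (leq_trans IH).
Qed.

(** A word that is not made of spins only has shorter sections, so an induction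
    along sections ends at products of spins. *)
Lemma word_contraction_ind (Q : (nat -> 'I_3) -> seq letter -> Prop) :
  (forall w u, all isSome u -> Q w u) ->
  (forall w u, (forall x, Q (shift w) (section w x u)) -> Q w u) ->
  forall w u, Q w u.
Proof.
move=> Qspin Qstep w u; have [n] := ubnP (size u).
elim: n => // n IH in w u *; rewrite ltnS => le_un.
have [/Qspin//|nall] := boolP (all isSome u).
apply: Qstep => x; apply: IH; apply: leq_ltn_trans (size_section w x u) _.
apply: leq_trans le_un; rewrite ltn_neqAle count_size andbT.
by rewrite -all_count.
Qed.

(** * Spins form a Klein four-group *)

Definition klein_word (o : letter) : seq letter := if o is None then [::] else [:: o].

Definition klein (w : nat -> 'I_3) (g : tree_aut) : Prop :=
  exists o, g = word_aut w (klein_word o).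

(** The letter of the sequence differs from exactly two of the three indices,
    so below a digit 0 the number of nontrivial spins is even. *)
Lemma spin_wordM (j k l : 'I_3) w v : uniq [:: j; k; l] ->
  spin_word j w (spin_word k w v) = spin_word l w v.
Proof.
move=> Ujkl; elim: v w => [|[] v IH] w //=; first by rewrite IH.
congr (_ :: _); move: (w 0) Ujkl => {}w.
by case: j k l w {IH} => [[|[|[|]]]] // ? [[|[|[|]]]] // ? [[|[|[|]]]] // ?
  [[|[|[|]]]] //= ? _; rewrite ?flip_wordK.
Qed.

Lemma third_letter (j k : 'I_3) : j != k -> exists l, uniq [:: j; k; l].
Proof.
move=> jk; have [l] : exists l, l \notin [:: j; k].
  apply/existsP; rewrite -[[exists _, _]]negbK negb_exists; apply/negP => /forallP all_in.
  have /subset_leq_card : 'I_3 \subset [:: j; k].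
    by apply/fintype.subsetP => l _; have := all_in l; rewrite negbK.
  by rewrite card_ord (card_uniqP _) //= inE jk.
move=> b; exists l; rewrite -[[:: j; k; l]]/(rcons [:: j; k] l).
by rewrite rcons_uniq b /= inE jk.
Qed.

Lemma spins_klein w u : all isSome u -> klein w (word_aut w u).
Proof.
elim: u => [|[k|] u IH] //= => [_|/IH[[j|] ->]]; first by exists None.
- have [->|kj] := eqVneq k j.
    exists None; apply: tree_aut_ext => v /=; exact: spin_wordK.
  have [l Ul] := third_letter kj; exists (Some l).
  by apply: tree_aut_ext => v /=; apply: spin_wordM.
- by exists (Some k).
Qed.

(** * Parity invariants and the dihedral quotient *)

Lemma swaps_det w u u' : word_aut w u = word_aut w u' -> swaps u = swaps u'.
Proof.
move=> /(congr1 (fun g : tree_aut => g [:: false])).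
by rewrite !word_aut_section /= => -[].
Qed.

Lemma section_det w x u u' : word_aut w u = word_aut w u' ->
  word_aut (shift w) (section w x u) = word_aut (shift w) (section w x u').
Proof.
move=> E; apply: tree_aut_ext => v.
have := congr1 (fun g : tree_aut => g (x :: v)) E.
by rewrite /= !word_aut_section => -[].
Qed.

(** The parity of the number of spins of index other than [k].  It vanishes on
    [a] and on the spin [k], and takes the value 1 on the two other spins. *)
Definition active (k : 'I_3) (u : seq letter) : bool :=
  odd (count (fun l : letter => if l is Some j then j != k else false) u).

Lemma active_cons k l u :
  active k (l :: u) = (if l is Some j then j != k else false) (+) active k u.
Proof. by rewrite /active /= oddD; case: l => // j; case: (j != k). Qed.

(** Each spin reappears in one of the two sections. *)
Lemma active_section k w u :
  active k (section w false u) (+) active k (section w true u) = active k u.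
Proof.
elim: u => [|[j|] u IH] //; rewrite active_cons -IH /=.
by case: (swaps u); case: ifP => _ /=; rewrite !active_cons /=;
  move: (j != k) (active k _) (active k _) => [] [] [].
Qed.

(** A spin produces a letter [a] in one of the sections exactly when its index
    differs from the current letter of the sequence. *)
Lemma swaps_section w u :
  swaps (section w false u) (+) swaps (section w true u) = active (w 0) u.
Proof.
elim: u => [|[j|] u IH] //; rewrite active_cons -IH /= -(eq_sym j).
by case: (swaps u); case: ifP => _ /=; rewrite !swaps_cons /=;
  do 2!case: (swaps (section _ _ _)).
Qed.

Lemma active_third j k l u : uniq [:: j; k; l] ->
  active j u (+) active k u = active l u.
Proof.
move=> Ujkl; elim: u => [|[m|] u IH] //; rewrite !active_cons -IH //.
rewrite addbACA; congr (_ (+) _); case: j k l m Ujkl {IH} =>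
  [[|[|[|]]]] // ? [[|[|[|]]]] // ? [[|[|[|]]]] // ? [[|[|[|]]]] //= ? _.
Qed.

(** For the letter [w 0] the parity is the total number of swaps on level 1, and
    for [w 1] on level 2, so both can be read from the action on the tree.  As
    these letters differ, the parity for the remaining index is their sum. *)
Lemma active_det k w u u' : w 0 != w 1%N ->
  word_aut w u = word_aut w u' -> active k u = active k u'.
Proof.
move=> w01 E.
have det0 w' v v' : word_aut w' v = word_aut w' v' -> active (w' 0) v = active (w' 0) v'.
  by move=> E'; rewrite -!(swaps_section w'); congr (_ (+) _);
    apply: swaps_det; apply: section_det.
have det1 : active (w 1%N) u = active (w 1%N) u'.
  by rewrite -(active_section _ w u) -(active_section _ w u'); congr (_ (+) _);
    apply: (det0 (shift w)); apply: section_det.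
have [->|k0] := eqVneq k (w 0); first exact: det0.
have [->//|k1] := eqVneq k (w 1%N).
have U : uniq [:: w 0; w 1%N; k].
  by rewrite /= !inE negb_or w01 !(eq_sym _ k) k0 k1.
by rewrite -!(active_third _ U) det1 (det0 w _ _ E).
Qed.

(** The image in the wreath product of two groups of order 2, which is dihedral
    of order 8: the spin [k] is trivial there, and [a] and the common image of the
    other two spins are reflections generating the group. *)
Definition octal (w : nat -> 'I_3) (k : 'I_3) (u : seq letter) : bool * bool * bool :=
  (active k (section w false u), active k (section w true u), swaps u).

Arguments octal : simpl never.

(** The automorphism of the dihedral group of order 8 exchanging the image of
    [a] with the image of the spins of index other than [k]. *)
Definition octal_swap (q : bool * bool * bool) : bool * bool * bool :=
  let: (x, y, s) := q in (if s then y else x, if s then ~~ y else x, x (+) y).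

Lemma octal_cons w k l u : octal w k (l :: u) =
  let: (x, y, s) := octal w k u in
  if l is Some j then (x (+) (s && (j != k)), y (+) (~~ s && (j != k)), s)
  else (x, y, ~~ s).
Proof.
rewrite /octal swaps_cons /=; case: l => [j|] //=.
by case: (swaps u); case: ifP => _; rewrite !active_cons /= ?addbF // addbC.
Qed.

Arguments octal_swap : simpl never.

(** A spin of index [j] contributes the spin [j] to one section and, when
    [j != w 0], a letter [a] to the other; when [j = w 0] both contributions
    are trivial in the dihedral quotient.  So left multiplication by a spin acts
    on the two images by exchanged generators. *)
Lemma octal_section w u :
  octal (shift w) (w 0) (section w false u) =
  octal_swap (octal (shift w) (w 0) (section w true u)).
Proof.
elim: u => [|[j|] u IH] //=; rewrite eq_sym.
case: (boolP (j != w 0)) => jw; case: (swaps u) => /=; rewrite !octal_cons ?jw ?(negPf jw) IH;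
  by case: (octal _ _ (section w true u)) => -[[] []] [].
Qed.

Lemma octal_klein w k o : octal w k (klein_word o) =
  (false, if o is Some j then j != k else false, false).
Proof. by case: o => [j|] //; rewrite octal_cons. Qed.

(** The quotient of order 8 is one of the group and not only of words. *)
Lemma octal_det w k u u' : without_repetition w ->
  word_aut w u = word_aut w u' -> octal w k u = octal w k u'.
Proof.
move=> hw E; rewrite /octal (swaps_det E).
by congr (_, _, _); apply: (active_det _ (hw 1%N : shift w 0 != shift w 1%N)); apply: section_det.
Qed.

(** * Rays and the two sides of the line *)

Definition ray_cons (x : bool) (y : ray) : ray := fun n => if n is m.+1 then y m else x.

Lemma ray_consE y : y = ray_cons (y 0) (fun n => y n.+1).
Proof. by apply/funext => -[]. Qed.

Lemma ray_cons_inj x x' y y' : ray_cons x y = ray_cons x' y' -> x = x' /\ y = y'.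
Proof.
move=> E; split; first exact: (congr1 (@^~ 0) E).
by apply/funext => n; apply: (congr1 (@^~ n.+1) E).
Qed.

Lemma zero_ray_cons : zero_ray = ray_cons false zero_ray.
Proof. by apply/funext => -[]. Qed.

Lemma one_zero_ray_cons : one_zero_ray = ray_cons true zero_ray.
Proof. by apply/funext => -[]. Qed.

Lemma ray_act_cons (g g' : tree_aut) x x' y :
  (forall v, g (x :: v) = x' :: g' v) ->
  ray_act g (ray_cons x y) = ray_cons x' (ray_act g' y).
Proof.
move=> E; apply/funext => n; rewrite /ray_act.
have -> : mkseq (ray_cons x y) n.+1 = x :: mkseq y n.
  by rewrite /mkseq /= -[in LHS](addn0 1%N) iotaDl -map_comp.
by rewrite E; case: n.
Qed.

Lemma ray_act_section w u x y : ray_act (word_aut w u) (ray_cons x y) =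
  ray_cons (x (+) swaps u) (ray_act (word_aut (shift w) (section w x u)) y).
Proof. by apply: ray_act_cons => v; apply: word_aut_section. Qed.

Lemma ray_act_flip x y : ray_act flip_aut (ray_cons x y) = ray_cons (~~ x) y.
Proof. by rewrite -[y in RHS](congr1 (@^~ y) ray_act1); apply: ray_act_cons. Qed.

Lemma ray_act_spin1 k w y :
  ray_act (spin_aut k w) (ray_cons true y) = ray_cons true (ray_act (spin_aut k (shift w)) y).
Proof. exact: ray_act_cons. Qed.

Lemma ray_act_spin0 (k : 'I_3) w y : ray_act (spin_aut k w) (ray_cons false y) =
  ray_cons false (if w 0 != k then ray_act flip_aut y else y).
Proof.
have -> : (if w 0 != k then ray_act flip_aut y else y) =
  ray_act (if w 0 != k then flip_aut else 1) y by case: ifP; rewrite ?ray_act1.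
apply: ray_act_cons => v /=; rewrite -val_eqE /=; by case: ifP.
Qed.

(** The complement of [ends e i] among finitely supported rays is
    [ends (~~ e) (~~ i)]; keeping the parity as a parameter avoids speaking of
    complements. *)
Definition ends (e i : bool) : set ray :=
  [set y | (y = zero_ray /\ e) \/
     exists m, [/\ odd m = i, y m & forall k, m < k -> ~~ y k]].

Lemma ends_zero e i : ends e i zero_ray <-> e.
Proof. by split=> [[[]//|[m []//]]|]; left. Qed.

(** The ray [1 0^oo] has its last 1 at the even index 0, which decides whether
    the zero ray belongs to the trace on the half tree below the digit 1. *)
Lemma ends_cons e i x y :
  ends e i (ray_cons x y) <-> ends (if x then ~~ i else e) (~~ i) y.
Proof.
split.
- case=> [[E Ee]|[[|m] [<- ym ym0]]].
  + by move: E; rewrite zero_ray_cons => /ray_cons_inj[-> ->]; left.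
  + left; rewrite (ym : x = true); split=> //.
    by apply/funext => n; apply/negbTE; apply: (ym0 n.+1).
  + by right; exists m; split=> [||k mk] //=; rewrite ?negbK //; apply: (ym0 k.+1).
- case=> [[-> ]|[m [mi ym ym0]]].
  + case: x => [ni|Ee]; last by left; rewrite -zero_ray_cons.
    by right; exists 0; split=> [||[]] //; rewrite -[i]negbK ni.
  + right; exists m.+1; split=> [||[|k]] //=; first by rewrite mi negbK.
    exact: ym0.
Qed.

(** The dihedral group of order 8 generated by [a] and the spin [w 0], whose
    sections are trivial at 0 and the spin [w 0] at 1. *)
Definition dihedral (w : nat -> 'I_3) (g : tree_aut) : Prop :=
  exists s (i : bool -> bool), forall x v, g (x :: v) =
    (x (+) s) :: word_aut (shift w) (nseq (i x) (Some (w 0))) v.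

(** A spin either fixes [0^oo] or exchanges it with [010^oo], whose last 1 has
    index 1; the second case imposes [e = i = e']. *)
Lemma klein_ends w o e e' i :
  (forall y, ends e i y <-> ends e' i (ray_act (word_aut w (klein_word o)) y)) ->
  e = e' /\ (e = ~~ i -> o = None \/ o = Some (w 0)).
Proof.
case: o => [k|] E; last first.
  have := E zero_ray; rewrite /= ray_act1 !ends_zero => ee'.
  by split; [apply/idP/idP => /ee' | left].
have Ek y : ends e i y <-> ends e' i (ray_act (spin_aut k w) y).
  by rewrite E /= mulg1.
have := Ek zero_ray; have := Ek (ray_cons false one_zero_ray).
rewrite {2}zero_ray_cons !ray_act_spin0; case: eqVneq => [<-|_] /=.
  rewrite -zero_ray_cons !ends_zero => _ ee'.
  by split; [apply/idP/idP => /ee' | right].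
rewrite zero_ray_cons one_zero_ray_cons !ray_act_flip /= !ends_cons !negbK.
rewrite !ends_zero => ie' ei.
have -> : e = i by apply/idP/idP => /ei.
by split; [apply/idP/idP => /ie' | case: (i)].
Qed.

(** The section at 1 always relates sets whose parameters satisfy [e = i], hence
    is a spin or trivial.  If [e = i] the section at 0 is in the dihedral group of
    order 8; its image in the octal quotient, dictated by the section at 1,
    singles out one element of that group.  If [e <> i] both sections are spins or
    trivial, and the same relation leaves only the spin [w 0]. *)
Lemma stabiliser_ends w u e e' i : without_repetition w ->
  (forall y, ends e i y <-> ends e' i (ray_act (word_aut w u) y)) ->
  [/\ e = e', e = i -> klein w (word_aut w u)
    & e = ~~ i -> dihedral w (word_aut w u)].
Proof.
move: w u e e' i; apply: word_contraction_ind => [w u /(@spins_klein w)[o ->]|w u IH] e e' i hw E.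
  have [ee' Eo] := klein_ends E; split=> [//|_|/Eo]; first by exists o.
  move=> o0; exists false, (fun x => x && (o != None)) => x v.
  case: o0 => ->; first by rewrite /= andbF addbF.
  by case: x => //=; rewrite eqxx.
have hw' : without_repetition (shift w) by move=> j; apply: hw.
have Ex x : [/\ (if x then ~~ i else e) = (if x (+) swaps u then ~~ i else e'),
   (if x then ~~ i else e) = ~~ i ->
     klein (shift w) (word_aut (shift w) (section w x u))
 & (if x then ~~ i else e) = i ->
     dihedral (shift w) (word_aut (shift w) (section w x u))].
  have := IH x (if x then ~~ i else e) (if x (+) swaps u then ~~ i else e') (~~ i) hw'.
  rewrite negbK; apply => y.
  by rewrite -ends_cons E ray_act_section ends_cons.
have [E0 K0 D0] := Ex false; have [E1 /(_ erefl)[o1 Eo1] _] := Ex true.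
have hw01 : shift w 0 != shift w 1%N := hw 1%N.
have oct1 : octal (shift w) (w 0) (section w true u) =
    (false, if o1 is Some j then j != w 0 else false, false).
  by rewrite (octal_det (w 0) hw' Eo1) octal_klein.
have := octal_section w u; rewrite oct1 /octal_swap /= => oct0.
split.
- by move: E0 E1; case: (swaps u) => /= [-> <-|].
- move=> ei; have {D0} [s [j Ej]] := D0 ei.
  have s0 : swaps u = false.
    by apply/negbTE/negP => su; move: E0; rewrite su /= ei; case: (i).
  (* The element is the spin found in the section at 1. *)
  exists o1; apply: tree_aut_ext => -[|x v]; first by rewrite !taut_root.
  rewrite word_aut_section s0 addbF.
  case: x; first by rewrite Eo1; case: (o1) => //= k; rewrite mulg1.
  have Esec0 x : word_aut (shift (shift w)) (section (shift w) x (section w false u)) =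
      word_aut (shift (shift w)) (nseq (j x) (Some (shift w 0))).
    by apply: tree_aut_ext => v'; have := Ej x v'; rewrite word_aut_section => -[].
  case: oct0 => a0 a1 sw.
  (* Sections two levels below are powers of the spin [w 1], which the parity
     [active (w 0)] detects because [w 0 != w 1]. *)
  have j0 x : j x = false.
    have : active (w 0) (section (shift w) x (section w false u)) = false by case: x.
    rewrite (active_det _ (hw' 1%N) (Esec0 x)); case: (j x) => //.
    by rewrite /active /= eq_sym (hw 0).
  rewrite -[word_aut w (klein_word o1) _]/(taut _ _).
  case: v => [|x v]; first by rewrite taut_root; case: (o1) => //= k; case: ifP.
  rewrite word_aut_section Esec0 j0 sw /=.
  by case: (o1) => [k|] //=; rewrite -?val_eqE ?addbF //= eq_sym;
    case: eqP; rewrite /= ?addbF ?addbT.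
- move=> ei; have {K0} [o0 Eo0] := K0 ei.
  have [o1E o0E] : (if o1 is Some j then j != w 0 else false) = false /\
      (if o0 is Some j then j != w 0 else false) = false.
    by move: oct0; rewrite (octal_det (w 0) hw' Eo0) octal_klein => -[-> <-].
  exists (swaps u), (fun x => (if x then o1 else o0) != None) => x v.
  rewrite word_aut_section; congr (_ :: _); case: x; rewrite (Eo0, Eo1).
    by case: (o1) o1E => //= k /negbFE/eqP->.
  by case: (o0) o0E => //= k /negbFE/eqP->.
Qed.

(** * Finiteness of stabilisers *)

Definition glue (p : bool * ((seq bool -> seq bool) * (seq bool -> seq bool)))
    (v : seq bool) : seq bool :=
  if v is x :: v' then (x (+) p.1) :: (if x then p.2.2 else p.2.1) v' else [::].

Definition glued (M : set (seq bool -> seq bool)) : set (seq bool -> seq bool) :=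
  glue @` (setT `*` (M `*` M)).

Lemma finite_glued M : finite_set M -> finite_set (glued M).
Proof.
by move=> fM; apply: finite_image; apply: finite_setX; [|apply: finite_setX].
Qed.

Lemma glued_aut M (g : tree_aut) s (f : bool -> seq bool -> seq bool) :
  (forall x v, g (x :: v) = (x (+) s) :: f x v) -> (forall x, M (f x)) ->
  glued M g.
Proof.
move=> E Mf; exists (s, (f false, f true)); first by split=> //; split; apply: Mf.
by apply/funext => -[|[] v]; rewrite /= ?taut_root ?E.
Qed.

(** The maps whose sections at level [n] belong to [M] at the shifted sequence. *)
Fixpoint eventual (M : (nat -> 'I_3) -> set (seq bool -> seq bool)) n w :=
  if n is m.+1 then glued (eventual M m (shift w)) else M w.

Definition core w : set (seq bool -> seq bool) :=
  [set taut g | g in [set g | klein w g \/ dihedral w g]].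

Lemma finite_klein w : finite_set [set taut g | g in klein w].
Proof.
apply: (@sub_finite_set _ _ [set taut (word_aut w (klein_word o)) | o in setT]).
  by move=> _ [g [o ->] <-]; exists o.
exact: finite_image.
Qed.

Lemma finite_core w : finite_set (core w).
Proof.
apply: (@sub_finite_set _ _
  ([set taut g | g in klein w] `|` glued [set taut g | g in klein (shift w)])).
  move=> _ [g [Kg|[s [i Ei]]] <-]; [by left; exists g|right].
  apply: (glued_aut Ei) => x; eexists; last by [].
  by exists (if i x then Some (w 0) else None); case: (i x).
rewrite finite_setU; split; first exact: finite_klein.
apply: finite_glued; exact: finite_klein.
Qed.

Lemma finite_eventual_core n w : finite_set (eventual core n w).
Proof.
elim: n w => [|n IH] w /=; first exact: finite_core.
by apply: finite_glued; apply: IH.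
Qed.

(** The value [e] may differ between the subtrees of level [n]. *)
Fixpoint ends_below (n : nat) (i : bool) (X : set ray) : Prop :=
  if n is m.+1 then forall x, ends_below m (~~ i) [set y | X (ray_cons x y)]
  else exists e, X = ends e i.

Lemma stabiliser_ends_below n w u i X Y : without_repetition w ->
  ends_below n i X -> ends_below n i Y ->
  (forall y, X y <-> Y (ray_act (word_aut w u) y)) ->
  eventual core n w (word_aut w u).
Proof.
elim: n w u i X Y => [|n IH] w u i X Y hw /=.
  move=> [e ->] [e' ->] /(stabiliser_ends hw)[_ Kl Di]; eexists; last by [].
  have [/Kl|/eqP ei] := eqVneq e i; [by left | right].
  by apply: Di; case: (e) (i) ei => [] [].
move=> HX HY E; apply: (glued_aut (word_aut_section w u)) => x.
apply: IH (HX x) (HY (x (+) swaps u)) _; first by move=> j; apply: hw.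
by move=> y /=; rewrite E ray_act_section.
Qed.

(** On a subtree of level [n] only the zero ray can be moved in or out. *)
Lemma ends_below_finite_diff n e i X :
  (forall y, (ends e i `+` X) y -> forall k, n <= k -> ~~ y k) ->
  ends_below n i X.
Proof.
elim: n e i X => [|n IH] e i X E.
  (* The zero ray is the only one at which [X] and [ends e i] may differ. *)
  exists `[< X zero_ray >]; apply/funext => y; apply/propext.
  have [->|y0] := pselect (y = zero_ray).
    by rewrite ends_zero; split=> /asboolP.
  have nE : ~ (ends e i `+` X) y.
    move=> /E yk; apply: y0; apply/funext => k; exact/negbTE/yk.
  have e2 e' : ends e' i y <-> ends e i y.
    by split=> -[[]//|?]; right.
  rewrite e2; split=> H; apply: contrapT => H'; apply: nE; [by right | by left].
move=> x /=; apply: (IH (if x then ~~ i else e)) => y D k nk.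
apply: (E (ray_cons x y) _ k.+1 nk).
by case: D => -[]; rewrite -ends_cons; [left | right].
Qed.

(** * The right half of the line *)

(** Edges of the line outside [0^oo], without the requirement of lying in the
    orbit of [0^oo], so that they can be transported between sequences. *)
Definition step (w : nat -> 'I_3) (x y : ray) : Prop :=
  [/\ x <> zero_ray, y <> zero_ray & exists l, y = ray_act (letter_aut w l) x].

Notation reach w := (clos_refl_sym_trans ray (step w)).

Lemma ray_cons_neq0 x y : y <> zero_ray -> ray_cons x y <> zero_ray.
Proof. by move=> y0; rewrite zero_ray_cons => /ray_cons_inj[]. Qed.

Lemma active_letter (w : nat -> 'I_3) : exists k : 'I_3, w 0 != k.
Proof. by have [->|?] := eqVneq (w 0) ord0; [exists ord_max | exists ord0]. Qed.

Lemma step_spin (w : nat -> 'I_3) y : ray_act flip_aut y <> zero_ray ->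
  y <> zero_ray -> step w (ray_cons false y) (ray_cons false (ray_act flip_aut y)).
Proof.
move=> fy0 y0; split; try exact: ray_cons_neq0.
by have [k wk] := active_letter w; exists (Some k); rewrite /= ray_act_spin0 wk.
Qed.

Lemma reach_flip w x x' y : y <> zero_ray -> reach w (ray_cons x y) (ray_cons x' y).
Proof.
move=> y0; have [->|xx'] := eqVneq x x'; first exact: rst_refl.
apply: rst_step; split; try exact: ray_cons_neq0.
by exists None; rewrite ray_act_flip; move: x x' xx' => [] [].
Qed.

(** A step [a] below the digit 0 is made by an active spin, a spin below the
    digit 1 is made by the same spin, and between them the first digit is
    adjusted by [a]; none of these passes through [0^oo]. *)
Lemma reach_cons w x x' y y' : y <> zero_ray -> reach (shift w) y y' ->
  reach w (ray_cons x y) (ray_cons x' y').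
Proof.
move=> y0 R; have y'0 : y' <> zero_ray.
  suff: y <> zero_ray <-> y' <> zero_ray by tauto.
  by elim: R {y0} => {y y'} [y y' []|//|y y' _ ->|y y' z _ -> _ ->].
suff: forall x, reach w (ray_cons x y) (ray_cons x y').
  by move=> H; apply: rst_trans (H x) (reach_flip _ _ _ _).
elim: R {y0 y'0 x x'} => {y y'} [y y' [y0 y'0 [l E]] x|y x|y y' _ H x|y y' z _ H _ H' x].
- case: l E => [k|] E.
    apply: rst_trans (reach_flip _ _ true y0) _.
    apply: rst_trans _ (reach_flip _ true _ y'0).
    apply: rst_step; split; try exact: ray_cons_neq0.
    by exists (Some k); rewrite /= ray_act_spin1 E.
  apply: rst_trans (reach_flip _ _ false y0) _.
  apply: rst_trans _ (reach_flip _ false _ y'0).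
  by apply: rst_step; rewrite E; apply: step_spin; rewrite // -/(letter_aut w None) -E.
- exact: rst_refl.
- exact/rst_sym/H.
- exact: rst_trans (H x) (H' x).
Qed.

Lemma ray_neq0 (y : ray) k : y k -> y <> zero_ray.
Proof. by move=> + E; rewrite E. Qed.

(** The block of rays whose last 1 has index [m] is connected, and [1 0^oo] is
    joined to [1010^oo] in the block of [m = 2] by an active spin; hence the
    blocks of equal parity are joined without meeting [0^oo]. *)
Lemma reach_last w (y : ray) m : y m -> (forall k, m < k -> ~~ y k) ->
  reach w (if odd m then ray_cons false one_zero_ray else one_zero_ray) y.
Proof.
have z1 : one_zero_ray <> zero_ray by apply: (@ray_neq0 _ 0).
elim: m w y => [|m IH] w y ym ym0.
  suff -> : y = one_zero_ray by apply: rst_refl.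
  by apply/funext => -[|k]; [apply: ym | apply/negbTE/ym0].
rewrite (ray_consE y); have := IH (shift w) (fun n => y n.+1) ym (fun k => ym0 k.+1).
rewrite /=; case: (odd m) => /= R; last exact: reach_cons.
apply: rst_trans (reach_cons true (y 0) _ R); last exact: ray_cons_neq0.
apply: rst_step; split=> //; first by do 2!apply: ray_cons_neq0.
have [k wk] := active_letter (shift w); exists (Some k).
rewrite one_zero_ray_cons /= ray_act_spin1 zero_ray_cons ray_act_spin0 wk.
by rewrite zero_ray_cons ray_act_flip -!zero_ray_cons.
Qed.

Lemma letter_autK w l : involutive (ray_act (letter_aut w l)).
Proof.
move=> y; have /gensV E : gens w (letter_aut w l) by apply/gensP; exists l.
have := ray_actM (letter_aut w l)^-1 (letter_aut w l).
by rewrite mulVg E ray_act1 => /(congr1 (@^~ y)).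
Qed.

(** Flipping the first digit changes the last 1 only when it exchanges [0^oo]
    and [10^oo], and [e = ~~ i] puts both of them in the set or both outside. *)
Lemma ends_flip i y : ends (~~ i) i y -> ends (~~ i) i (ray_act flip_aut y).
Proof. by rewrite (ray_consE y) ray_act_flip !ends_cons; case: (y 0). Qed.

(** Below the first digit 0 a spin is trivial or a flip, so this reduces to
    [ends_flip] after as many steps as there are leading digits 1. *)
Lemma ends_spin (k : 'I_3) w i y : ends i i y -> ends i i (ray_act (spin_aut k w) y).
Proof.
move=> Ey; have [n yn] : exists n, forall j, n <= j -> ~~ y j.
  by case: Ey => [[-> _]|[m [_ _ ym]]]; [exists 0 | exists m.+1].
elim: n w i y yn Ey => [|n IH] w i y yn;
  rewrite (ray_consE y); case E: (y 0); rewrite ?ray_act_spin1 ?ray_act_spin0 !ends_cons.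
- by have := yn 0 isT; rewrite E.
- by case: ifP => // _; rewrite -{1 3}[i]negbK; apply: ends_flip.
- by apply: IH => j nj; apply: yn.
- by case: ifP => // _; rewrite -{1 3}[i]negbK; apply: ends_flip.
Qed.

Lemma ends_nonzero e e' i y : y <> zero_ray -> ends e i y -> ends e' i y.
Proof. by move=> y0 [[]//|?]; right. Qed.

Lemma ends_step w x y : step w x y -> ends false false x <-> ends false false y.
Proof.
have H x' y' : step w x' y' -> ends false false x' -> ends false false y'.
  move=> [x0 y0 [[k|] E]]; rewrite E in y0 *; first exact: ends_spin.
  by move=> /(ends_nonzero true x0)/(@ends_flip false); apply: ends_nonzero.
move=> S; split; first exact: H.
by apply: H; case: S => x0 y0 [l E]; split=> //; exists l; rewrite E letter_autK.
Qed.

Lemma reach_Gamma_V w x y : reach w x y -> Gamma_V w x <-> Gamma_V w y.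
Proof.
elim=> {x y} [x y [_ _ [l ->]]|//|x y _ ->//|x y z _ -> _ ->//].
have G : grigorchuk w (letter_aut w l) by apply: sub_gen_smallest; apply/gensP; exists l.
by split=> [|/(Gamma_V_act G)]; [exact: Gamma_V_act | rewrite letter_autK].
Qed.

Lemma reach_component w x y : Gamma_V w x -> reach w x y -> component_off_zero w x y.
Proof.
move=> + R; elim: R => {x y} [x y [x0 y0 [l E]] Vx|x _|x y R IH Vy|x y z R IH R' IH' Vx].
- by apply: rst_step; split=> //; split=> //; exists (letter_aut w l); rewrite // gensP; exists l.
- exact: rst_refl.
- by apply/rst_sym/IH/(reach_Gamma_V R).
- by apply: rst_trans (IH Vx) (IH' _); apply/(reach_Gamma_V R).
Qed.

Lemma Gamma_V_one_zero w : Gamma_V w one_zero_ray.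
Proof.
exists gen_a; first by apply: sub_gen_smallest; left; left; left.
by rewrite zero_ray_cons ray_act_flip -one_zero_ray_cons.
Qed.

Lemma Gamma_plusE w : Gamma_plus w = ends true false.
Proof.
apply/seteqP; split=> y.
  move=> [->|R]; first by apply/ends_zero.
  suff : ends false false y by case=> [[]//|?]; right.
  have : ends false false one_zero_ray by rewrite one_zero_ray_cons ends_cons ends_zero.
  suff -> : ends false false one_zero_ray <-> ends false false y by [].
  elim: R => {y} [x y [x0 y0 [_ [s /gensP[l ->] E]]]|//|x y _ ->//|x y z _ -> _ ->//].
  by apply: (@ends_step w); split=> //; exists l.
case=> [[-> _]|[m [m_even ym ym0]]]; first by left.
right; apply: reach_component; first exact: Gamma_V_one_zero.
by have := reach_last w ym ym0; rewrite m_even.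
Qed.

Lemma Gamma_plus_V w : Gamma_plus w `<=` Gamma_V w.
Proof.
rewrite Gamma_plusE => y [[-> _]|[m [m_even ym ym0]]].
  by exists 1; [case: (generated_subgroup (gens w)) | rewrite ray_act1].
have := reach_last w ym ym0; rewrite m_even => /reach_Gamma_V <-.
exact: Gamma_V_one_zero.
Qed.

Lemma Gamma_V_finite w y : Gamma_V w y -> exists n, forall k, n <= k -> ~~ y k.
Proof.
move=> [_ /grigorchuk_word[u ->] <-] {y}; move: w u; apply: word_contraction_ind.
  move=> w u /(@spins_klein w)[[k|] ->]; last by exists 0; rewrite /= ray_act1.
  exists 2; rewrite /= mulg1 zero_ray_cons ray_act_spin0.
  by case: ifP => _ [|[|j]] // _; rewrite zero_ray_cons ray_act_flip.
move=> w u /(_ false)[n H]; exists n.+1; rewrite zero_ray_cons ray_act_section.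
by move=> [|k] //; apply: H.
Qed.

(** * The action on the cube complex *)

(** The supports of the finitely many rays in the symmetric difference with
    [Gamma_plus] are bounded by a common [n], which depends on the vertex only. *)
Lemma stabiliser_vertex_finite w Om : without_repetition w -> X_vertex w Om ->
  finite_set [set g | grigorchuk w g /\ set_act g Om = Om].
Proof.
move=> hw [OmV fin].
have [n Hn] : exists n, forall y, (ends true false `+` Om) y -> forall k, n <= k -> ~~ y k.
  move: fin; rewrite setYC Gamma_plusE => /finite_seqP[s Es].
  have sV y : y \in s -> Gamma_V w y.
    move=> ys; have : (ends true false `+` Om) y by rewrite Es.
    by case=> -[]; [rewrite -(Gamma_plusE w) => /Gamma_plus_V|move=> /OmV].
  suff [n Hn] : exists n, forall y, y \in s -> forall k, n <= k -> ~~ y k.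
    by exists n => y; rewrite Es; apply: Hn.
  elim: s sV {Es} => [|y s IH] sV; first by exists 0.
  have [|n Hn] := IH; first by move=> z zs; apply: sV; rewrite inE zs orbT.
  have [n' Hn'] := Gamma_V_finite (sV y (mem_head y s)).
  exists (maxn n n') => z; rewrite inE => /orP[/eqP->|/Hn H] k; rewrite geq_max => /andP[? ?].
    exact: Hn'.
  exact: H.
have HOm := ends_below_finite_diff Hn.
apply: (@sub_finite_set _ _ (taut @^-1` (eventual core n w))).
  move=> _ [/grigorchuk_word[u ->] E]; apply: (stabiliser_ends_below hw HOm HOm) => y.
  split=> [Oy|]; first by rewrite -E; exists y.
  by rewrite -{1}E => -[z Oz /ray_act_inj <-].
apply: finite_preimage; last exact: finite_eventual_core.
by move=> g h _ _ E; apply: tree_aut_ext => v; rewrite E.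
Qed.

(** The action preserves inclusion, so it fixes the smallest vertex [A] of any
    cube that it preserves. *)
Lemma cube_bottom_fixed (g : tree_aut) (A F : set ray) :
  let C := [set A `|` B | B in [set B | B `<=` F]] in
  set_act g @` C = C -> set_act g A = A.
Proof.
move=> C E; have CA : C A by exists set0; rewrite ?setU0 //; apply: sub0set.
apply/seteqP; split.
  have [_ [B _ <-]] : (set_act g @` C) A by rewrite E.
  by rewrite /set_act image_setU => {2}<-; apply: subsetUl.
have [B _ <-] : C (set_act g A) by rewrite -E; exists A.
exact: subsetUl.
Qed.

(** [Gamma_plus] and [Gamma_plus] minus [y] are both vertices. *)
Lemma vertices_separate w g y : Gamma_plus w y ->
  (forall Om, X_vertex w Om -> set_act g Om = Om) -> ray_act g y = y.
Proof.
move=> Py fix_g.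
have V1 : X_vertex w (Gamma_plus w).
  by split; [exact: Gamma_plus_V | rewrite setYK; apply: finite_set0].
have V2 : X_vertex w (Gamma_plus w `\ y).
  split; first by move=> z [/Gamma_plus_V].
  apply: (@sub_finite_set _ _ [set y]); last exact: finite_set1.
  by move=> z [[[Pz _] //]|[Pz nz]]; apply: contrapT => zy; apply: nz.
have : Gamma_plus w (ray_act g y) by rewrite -(fix_g _ V1); exists y.
move=> Pgy; apply: contrapT => gy.
have : (Gamma_plus w `\ y) (ray_act g y) by [].
by rewrite -(fix_g _ V2) => -[z [_ zy] /ray_act_inj/zy].
Qed.

Lemma word_extends_Gamma_plus w (v : seq bool) :
  exists2 y, Gamma_plus w y & mkseq y (size v) = v.
Proof.
(* The default value of [nth] places the last 1 at an even index past the end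
   of [v]. *)
rewrite Gamma_plusE; exists (fun n => nth (n == (size v).*2) v n).
  have v2 : size v <= (size v).*2 by rewrite -addnn leq_addr.
  right; exists (size v).*2; split=> [||k vk]; rewrite ?odd_double //.
    by rewrite nth_default // eqxx.
  by rewrite nth_default ?gtn_eqF // (leq_trans v2 (ltnW vk)).
apply: (@eq_from_nth _ false); rewrite size_mkseq // => j jv.
by rewrite nth_mkseq //; apply: set_nth_default.
Qed.

Theorem theorem3 (w : nat -> 'I_3) (hw : without_repetition w) :
  proper_action (grigorchuk w) set_act (X_cube w) /\
  faithful_action (grigorchuk w) set_act (X_vertex w).
Proof.
split=> [n C [A [F [_ _ XA _ ->]]]|g Gg fix_g].
  apply: sub_finite_set (stabiliser_vertex_finite hw XA) => g [Gg /cube_bottom_fixed Ag].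
  by split.
apply: tree_aut_ext => v; have [y Py <-] := word_extends_Gamma_plus w v.
by rewrite -mkseq_ray_act (vertices_separate Py fix_g).
Qed.
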